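(* Let $H$ be a real Hilbert space and $\Psi=F+R$, where $R:H\to\mathbb{R}\cup\{\pm\infty\}$ is proper, convex and lower semicontinuous; $F:H\to\mathbb{R}$ is convex and continuously Fréchet differentiable on $\operatorname{int}(\operatorname{dom}F)\supseteq\operatorname{dom}R$; and $\nabla F:H\to H$ is globally $L$-Lipschitz continuous ($L>0$). Suppose that $S_*\neq\emptyset$, let $\Psi^*:=\min_{H}\Psi$, and let $\{u_k\}_k$ be generated by the nonmonotone splitting algorithm described in the context. Then: (i) Every sequential weak accumulation point of $\{u_k\}_k$ belongs to $S_*$. (ii) $\{u_k\}_k$ converges weakly to a minimizer $u^*\in S_*$, and $P_{S_*}u_k\to u^*$ strongly, where $P_{S_*}$ is the orthogonal projection onto $S_*$. (iii) $\Psi(u_k)\to\Psi^*$ as $k\to\infty$, and there exist constants $\rho_1,\rho_2>0$ such that for all large enough $k\ge0$ $$\Psi(u_k)-\Psi^*\le\frac{\rho_1}{\rho_2+k}.$$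
   Context: For $u\in\operatorname{int}(\operatorname{dom}F)$, $\nabla F(u)\in H$ is the Riesz representative of the derivative $F'(u)$. $\partial R$ is the convex subdifferential. $S_*:=\{u\in H:-\nabla F(u)\in\partial R(u)\}$; in the present convex setting $S_*$ is the (closed, convex) set of minimizers of $\Psi$. For $\alpha>0$: $\operatorname{Prox}_{\frac1\alpha R}(u):=\operatorname{argmin}_{v\in H}\big(R(v)+\frac{\alpha}{2}\|v-u\|^2\big)$, $T_\alpha(u):=\operatorname{Prox}_{\frac1\alpha R}\big(u-\frac1\alpha\nabla F(u)\big)$, and $G_\alpha(u):=\alpha(u-T_\alpha(u))$ (gradient mapping). Nonmonotone splitting algorithm. Parameters: $0<\delta<1$, $m_{\max}\in\mathbb{N}_0$, $\eta>1$, $\alpha_{\sup}>\alpha_{\inf}>0$, $u_0\in H$, $\alpha_0>0$. Memory: $m(0)=0$, $m(k)=\min\{m(k-1)+1,m_{\max}\}$ for $k\ge1$. For $k=0,1,2,\dots$: stop if $G_\alpha(u_k)=0$ for some (equivalently every) $\alpha>0$; otherwise compute a Barzilai–Borwein value $\alpha_k^{BB}$, set $\alpha_{\mathrm{int},k}:=\max\{\alpha_{\inf},\min\{\alpha_{\sup},\alpha_k^{BB}\}\}$ and $\alpha_k:=\alpha_{\mathrm{int},k}\,\eta^{i_k}$, where $i_k\in\mathbb{N}_0$ is the smallest integer such that, with $u_{k+1}:=T_{\alpha_k}(u_k)=u_k-\frac{1}{\alpha_k}G_{\alpha_k}(u_k)$, $$\Psi(u_{k+1})\le\max_{0\le j\le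 m(k)}\Psi(u_{k-j})-\frac{\delta}{\alpha_k}\|G_{\alpha_k}(u_k)\|^2 .$$ Barzilai–Borwein values: $\alpha_0^{BB}:=\alpha_0$; for $k\ge1$, with $s=u_k-u_{k-1}$, $y=\nabla F(u_k)-\nabla F(u_{k-1})$, $z=G_{\alpha_{k-1}}(u_k)-G_{\alpha_{k-1}}(u_{k-1})$, the value $\alpha_k^{BB}$ is one of $\frac{(s,y)}{(s,s)},\ \frac{(y,y)}{(s,y)},\ \frac{(s,z)}{(s,s)},\ \frac{(z,z)}{(s,z)}$, or alternates between the first two, or between the last two (first of the pair for even $k$, second for odd $k$); if a denominator is zero any real value may be used. Assertions for all $k$ and about limits refer to the case in which the algorithm does not stop, so that $\{u_k\}_k$ is an infinite sequence. *)

(* Defs.v *)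
From HB Require Import structures.
From mathcomp Require Import all_boot all_order all_algebra.
From mathcomp Require Import all_classical all_reals all_analysis.

Set Implicit Arguments.
Unset Strict Implicit.
Unset Printing Implicit Defensive.

Import Order.TTheory GRing.Theory Num.Theory.
Import numFieldNormedType.Exports.

Local Open Scope classical_set_scope.
Local Open Scope ring_scope.

(* A real Hilbert space is a complete normed module whose norm comes from an
   inner product. *)
Definition induces_norm (R : realType) (H : completeNormedModType R)
    (dot : {dot H for idfun}) : Prop :=
  forall u : H, dot u u = `|u| ^+ 2.

Definition edom (R : realType) (H : Type) (f : H -> \bar R) : set H :=
  [set u | (f u < +oo)%E].

Definition proper_fun (R : realType) (H : Type) (f : H -> \bar R) : Prop :=
  (forall u, (-oo < f u)%E) /\ edom f !=set0.

(* Only meant for functions that never take the value -oo. *)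
Definition econvex (R : realType) (H : lmodType R) (f : H -> \bar R) : Prop :=
  forall (x y : H) (t : R), 0 < t -> t < 1 ->
    (f (t *: x + (1 - t) *: y)%R <= t%:E * f x + (1 - t)%:E * f y)%E.

(* f is continuously Frechet differentiable on the interior of its domain, the
   derivative being continuous for the operator norm. On that open set, f is
   locally finite, hence [fine \o f] is locally the same function as f. *)
Definition C1_on_interior (R : realType) (H : completeNormedModType R)
    (f : H -> \bar R) : Prop :=
  forall u : H, (edom f)° u ->
    differentiable (fine \o f : H -> R^o) u /\
    forall e : R, 0 < e ->
      \forall v \near u, forall h : H,
        `| 'd (fine \o f : H -> R^o) v h - 'd (fine \o f : H -> R^o) u h |
          <= e * `|h|.

(* g u is the Riesz representative of the derivative of f at u; g is not
   constrained off the interior of the domain of f. *)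
Definition is_gradient (R : realType) (H : completeNormedModType R)
    (dot : {dot H for idfun}) (f : H -> \bar R) (g : H -> H) : Prop :=
  forall u : H, (edom f)° u ->
    forall h : H, 'd (fine \o f : H -> R^o) u h = dot (g u) h.

Definition subdifferential (R : realType) (H : completeNormedModType R)
    (dot : {dot H for idfun}) (f : H -> \bar R) (u : H) : set H :=
  [set g | forall v, (f u + (dot g (v - u))%:E <= f v)%E].

Definition argmin (R : realType) (H : Type) (f : H -> \bar R) : set H :=
  [set v | forall w, (f v <= f w)%E].

Definition objective (R : realType) (H : Type) (F Reg : H -> \bar R) :
    H -> \bar R :=
  fun u => (F u + Reg u)%E.

Definition min_value (R : realType) (H : Type) (f : H -> \bar R) : \bar R :=
  ereal_inf (range f).

Definition stationary (R : realType) (H : completeNormedModType R)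
    (dot : {dot H for idfun}) (gradF : H -> H) (Reg : H -> \bar R) : set H :=
  [set u | subdifferential dot Reg u (- gradF u)].

(* The unique minimizer of Reg v + a / 2 * |v - u|^2, that is, the proximal map
   of Reg / a at u; the default value 0 is taken when there is no minimizer. *)
Definition prox (R : realType) (H : completeNormedModType R)
    (Reg : H -> \bar R) (a : R) (u : H) : H :=
  xget 0 (argmin (fun v : H => (Reg v + (a / 2 * `|v - u| ^+ 2)%:E)%E)).

Definition fb_step (R : realType) (H : completeNormedModType R)
    (gradF : H -> H) (Reg : H -> \bar R) (a : R) (u : H) : H :=
  prox Reg a (u - a^-1 *: gradF u).

Definition gradient_mapping (R : realType) (H : completeNormedModType R)
    (gradF : H -> H) (Reg : H -> \bar R) (a : R) (u : H) : H :=
  a *: (u - fb_step gradF Reg a u).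

Fixpoint memory (mmax k : nat) : nat :=
  if k is k'.+1 then minn (memory mmax k').+1 mmax else 0%N.

Definition window_max (R : realType) (H : Type) (Psi : H -> \bar R)
    (mmax : nat) (u : nat -> H) (k : nat) : \bar R :=
  \big[maxe/-oo%E]_(0 <= j < (memory mmax k).+1) Psi (u (k - j)%N).

Definition accepted (R : realType) (H : completeNormedModType R)
    (F : H -> \bar R) (gradF : H -> H) (Reg : H -> \bar R)
    (delta : R) (mmax : nat) (u : nat -> H) (k : nat) (a : R) : Prop :=
  (objective F Reg (fb_step gradF Reg a (u k)) <=
     window_max (objective F Reg) mmax u k
     - (delta / a * `|gradient_mapping gradF Reg a (u k)| ^+ 2)%:E)%E.

(* The two Barzilai-Borwein quotients; when the denominator vanishes, a is
   unconstrained. *)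
Definition bb_first (R : realType) (H : completeNormedModType R)
    (dot : {dot H for idfun}) (s w : H) (a : R) : Prop :=
  dot s s != 0 -> a = dot s w / dot s s.

Definition bb_second (R : realType) (H : completeNormedModType R)
    (dot : {dot H for idfun}) (s w : H) (a : R) : Prop :=
  dot s w != 0 -> a = dot w w / dot s w.

(* The quotient may be chosen anew at each iteration: using the same one
   throughout, or alternating between two of them according to the parity of
   k, are special cases. *)
Definition bb_value (R : realType) (H : completeNormedModType R)
    (dot : {dot H for idfun}) (s y z : H) (a : R) : Prop :=
  [\/ bb_first dot s y a, bb_second dot s y a,
      bb_first dot s z a | bb_second dot s z a].

(* An infinite run (one in which the stopping test never succeeds) with iterates
   u, step parameters alpha, Barzilai-Borwein values alphaBB and numbers of
   backtracking steps i. The initial parameter alpha_init is distinct from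
   alpha 0, which is the one obtained after safeguarding and backtracking. *)
Record splitting_run (R : realType) (H : completeNormedModType R)
    (dot : {dot H for idfun}) (F : H -> \bar R) (gradF : H -> H)
    (Reg : H -> \bar R)
    (delta : R) (mmax : nat) (eta alpha_inf alpha_sup alpha_init : R)
    (u : nat -> H) (alpha alphaBB : nat -> R) (i : nat -> nat) : Prop := {
  run_no_stop : forall k,
    ~ exists2 a : R, 0 < a & gradient_mapping gradF Reg a (u k) = 0 ;
  run_bb0 : alphaBB 0%N = alpha_init ;
  run_bb : forall k,
    bb_value dot
      (u k.+1 - u k)
      (gradF (u k.+1) - gradF (u k))
      (gradient_mapping gradF Reg (alpha k) (u k.+1)
       - gradient_mapping gradF Reg (alpha k) (u k))
      (alphaBB k.+1) ;
  run_alpha : forall k,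
    alpha k = Num.max alpha_inf (Num.min alpha_sup (alphaBB k)) * eta ^+ i k ;
  run_accepted : forall k,
    accepted F gradF Reg delta mmax u k (alpha k) ;
  run_smallest : forall k j, (j < i k)%N ->
    ~ accepted F gradF Reg delta mmax u k
        (Num.max alpha_inf (Num.min alpha_sup (alphaBB k)) * eta ^+ j) ;
  run_step : forall k, u k.+1 = fb_step gradF Reg (alpha k) (u k)
}.

Definition weak_cvg (R : realType) (H : completeNormedModType R)
    (dot : {dot H for idfun}) (u : nat -> H) (l : H) : Prop :=
  forall h : H, dot (u k) h @[k --> \oo] --> dot l h.

Definition weak_accumulation (R : realType) (H : completeNormedModType R)
    (dot : {dot H for idfun}) (u : nat -> H) (l : H) : Prop :=
  exists phi : nat -> nat,
    {homo phi : m n / (m < n)%N} /\ weak_cvg dot (u \o phi) l.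

(* The point of S nearest to u, with default value 0 when there is none. *)
Definition orth_proj (R : realType) (H : completeNormedModType R)
    (S : set H) (u : H) : H :=
  xget 0 [set p | S p /\ forall q, S q -> `|u - p| <= `|u - q|].

(* Main.v *)
Require Import Defs.
From HB Require Import structures.
From mathcomp Require Import all_boot all_order all_algebra.
From mathcomp Require Import all_classical all_reals all_analysis.
From mathcomp Require Import ring lra zify.

Import Order.TTheory GRing.Theory Num.Theory.
Import numFieldNormedType.Exports.

Local Open Scope classical_set_scope.
Local Open Scope ring_scope.

Set Implicit Arguments.
Unset Strict Implicit.
Unset Printing Implicit Defensive.

(** Write [x k = u k.+1], [d k = |x k.+1 - x k|] and [gap k] for the difference
    between the objective at [x k] and its minimum. The first iterate is skipped
    because [u 0] may lie outside the domain of [Reg]; every later one is a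
    proximal point, hence lies in it.

    The heart of the proof is that the squared steps are summable although the
    objective may increase along the run. Backtracking stops as soon as
    [a * (1 - delta) >= L], so the step parameters stay between [alpha_inf] and a
    constant ([alpha_bounded]). Comparing the optimality conditions of two
    successive proximal steps then gives [d k.+1 <= C * d k] ([fb_step_ratio]).
    The nonmonotone test alone controls just one step per window; since no step
    can be much longer than the steps before it, the last step of a window
    bounds all the others from below up to a constant factor, so each value of
    the next window, and therefore its maximum, is below the current maximum by a
    multiple of the square of that last step ([window_decrease]). Telescoping
    yields [sum_sq_bounded].

    Convexity gives, for every minimizer [v],
    [2 / A * gap k.+1 + |x k.+1 - v|^2 <= |x k - v|^2 + c * d k ^ 2]
    ([iterate_fejer]). Summing, the gaps are summable. Their maxima over windows
    are nonincreasing and summable as well, so they decay like [1 / k], which is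
    the rate ([nonmonotone_rate]). The same inequality makes [x] quasi-Fejer
    monotone with respect to the solution set [S], a sublevel set of the objective
    and thus closed and convex. For such a sequence the projections onto [S] form
    a Cauchy sequence; their limit [z] is the weak limit of [x]. Indeed,
    otherwise some functional stays away from its value at [z] along a
    subsequence; a point [l] common to the closed convex hulls of the tails of
    that subsequence belongs to [S] because the gaps tend to 0, and the
    variational inequality of the projections forces [l = z].

    No compactness theorem is used: minimizers of strongly convex functions are
    limits of minimizing sequences ([prox_exists]), projections are proximal
    points of indicator functions ([projection_exists]), and the point [l] is the
    limit of the projections of 0 onto the nested hulls ([weak_cluster_point]). *)

(** * Inner product and Cauchy sequences *)

Section InnerProduct.
Context (R : realType) (H : completeNormedModType R).
Context (dot : {dot H for idfun}) (hdot : induces_norm dot).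
Implicit Types x y z : H.

Lemma dotC x y : dot x y = dot y x.
Proof. by rewrite hermC expr0 mul1r. Qed.

Lemma dotDl x y z : dot (x + y) z = dot x z + dot y z.
Proof. exact: (linearDl dot z x y). Qed.

Lemma dotNl x y : dot (- x) y = - dot x y.
Proof. exact: (linearNl dot y x). Qed.

Lemma dotZl (a : R) x y : dot (a *: x) y = a * dot x y.
Proof. exact: (linearZl_LR dot y a x). Qed.

Lemma dotDr x y z : dot x (y + z) = dot x y + dot x z.
Proof. by rewrite !(dotC x) dotDl. Qed.

Lemma dotNr x y : dot x (- y) = - dot x y.
Proof. by rewrite !(dotC x) dotNl. Qed.

Lemma dotZr (a : R) x y : dot x (a *: y) = a * dot x y.
Proof. by rewrite !(dotC x) dotZl. Qed.

Definition dotE := (dotDl, dotDr, dotNl, dotNr, dotZl, dotZr).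

Lemma dot_ge0 x : 0 <= dot x x.
Proof. by rewrite hdot exprn_ge0. Qed.

Lemma sq_dist_le0 x y : `|x - y| ^+ 2 <= 0 -> x = y.
Proof.
by rewrite le_eqVlt ltNge exprn_ge0// orbF sqrf_eq0 normr_eq0 subr_eq0 => /eqP.
Qed.

Lemma dot_le_norm x y : dot x y <= `|x| * `|y|.
Proof.
have [->|x0] := eqVneq x 0.
  by move: (dotZl 0 0 y); rewrite scale0r normr0 !mul0r => ->.
have [->|y0] := eqVneq y 0.
  by move: (dotZr 0 x 0); rewrite scale0r normr0 mulr0 mul0r => ->.
have xy0 : 0 < `|x| * `|y| by rewrite mulr_gt0 ?normr_gt0.
rewrite -subr_ge0 -(pmulr_rge0 _ xy0).
have := dot_ge0 (`|y| *: x - `|x| *: y).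
by rewrite !dotE (dotC y x) !hdot; lra.
Qed.

Lemma norm_dot_le x y : `|dot x y| <= `|x| * `|y|.
Proof.
rewrite ler_norml dot_le_norm andbT lerNl -dotNl.
by apply: le_trans (dot_le_norm _ _) _; rewrite normrN.
Qed.

Lemma cvg_dotl {T : Type} {F : set_system T} {FF : Filter F} (f : T -> H) l y :
  f t @[t --> F] --> l -> dot (f t) y @[t --> F] --> dot l y.
Proof.
move=> fl; apply/cvgrPdist_lt => e e0.
have y1 : 0 < `|y| + 1 by rewrite ltr_wpDl.
have /cvgrPdist_lt/(_ _ (divr_gt0 e0 y1)) := fl; apply: filterS => t.
rewrite ltr_pdivlMr// => ht; apply: le_lt_trans ht.
rewrite -dotNl -dotDl; apply: le_trans (norm_dot_le _ _) _.
by apply: ler_wpM2l => //; rewrite lerDl.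
Qed.

End InnerProduct.

Section CauchySquares.
Context (R : realType) (H : completeNormedModType R).

(** Parallelogram-type arguments bound squares of distances; this is the form of
    the Cauchy criterion they feed. *)
Lemma cvg_dist_sq (x : nat -> H) (b : nat -> R) :
  (forall m n, (n <= m)%N -> `|x m - x n| ^+ 2 <= b n) ->
  b n @[n --> \oo] --> 0 -> cvgn x.
Proof.
move=> xb b0; apply/cauchy_cvgP/cauchy_exP => e e0.
have e2 : 0 < e ^+ 2 by rewrite exprn_gt0.
have /cvgrPdist_lt/(_ _ e2)[N _ bN] := b0.
exists (x N), N => // m /= Nm; rewrite -ball_normE /ball_ /= distrC.
rewrite -(ltr_pXn2r (n := 2))// ?nnegrE ?(ltW e0)//.
apply: le_lt_trans (xb _ _ Nm) _; apply: le_lt_trans (ler_norm _) _.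
by have := bN N (leqnn N); rewrite sub0r normrN.
Qed.

(** The bound makes [b] nonincreasing, hence convergent. For sequences of
    projections, [b] comes from squared distances and [sq_dist_projection]. *)
Lemma cvg_telescope_sq (x : nat -> H) (b : nat -> R) (c : R) :
  (forall m n, (n <= m)%N -> `|x m - x n| ^+ 2 <= b n - b m) ->
  (forall n, c <= b n) -> cvgn x.
Proof.
move=> xb cb.
have bdec : {homo b : n m / (n <= m)%N >-> m <= n}.
  move=> n m nm; rewrite -subr_ge0; apply: le_trans (xb _ _ nm).
  exact: exprn_ge0.
have bcvg : cvgn b by apply: nonincreasing_is_cvgn => //; exists c => _ [n _ <-].
apply: (@cvg_dist_sq _ (fun n => b n - limn b)) => [m n nm|].
  apply: le_trans (xb _ _ nm) _; rewrite lerB//.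
  exact: nonincreasing_cvgn_ge.
rewrite -(subrr (limn b)); apply: cvgB => //; exact: cvg_cst.
Qed.

End CauchySquares.

(** * Convex functions and proximal points *)

(** First-order conditions arise from comparing a minimizer with a point at
    parameter [t] of a segment: after division by [t] the second-order term is
    [t * y], and [t] tends to 0. *)
Lemma le0_of_small_mul (R : realType) (x y : R) :
  (forall t, 0 < t -> t < 1 -> x <= t * y) -> x <= 0.
Proof.
move=> xy; rewrite leNgt; apply/negP => x0.
have y0 : 0 < y by have := xy 2^-1; lra.
have t0 : 0 < x / (x + y) by rewrite divr_gt0// addr_gt0.
have t1 : x / (x + y) < 1 by rewrite ltr_pdivrMr; lra.
have xy0 : 0 < x + y by lra.
have := xy _ t0 t1; rewrite mulrAC ler_pdivlMr//; nra.
Qed.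

Lemma convex_combE (R : pzRingType) (V : lmodType R) (x y : V) (t : R) :
  t *: y + (1 - t) *: x = x + t *: (y - x).
Proof. by rewrite scalerBl scale1r scalerBr addrCA. Qed.

Section ConvexFunctions.
Context (R : realType) (H : completeNormedModType R).
Implicit Types (f : H -> \bar R) (x y v w : H).

Lemma edom_fineK f : (forall u, (-oo < f u)%E) ->
  forall x, edom f x -> f x = (fine (f x))%:E.
Proof. by move=> fNy x fx; rewrite fineK// fin_real// fNy. Qed.

Lemma econvex_edom f : econvex f -> (forall u, (-oo < f u)%E) ->
  forall x y (t : R), edom f x -> edom f y -> 0 < t -> t < 1 ->
  edom f (t *: x + (1 - t) *: y) /\
  fine (f (t *: x + (1 - t) *: y)) <= t * fine (f x) + (1 - t) * fine (f y).
Proof.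
move=> fcvx fNy x y t fx fy t0 t1.
have := fcvx x y t t0 t1; rewrite (edom_fineK fNy fx) (edom_fineK fNy fy) -!EFinM -EFinD => le.
have d : edom f (t *: x + (1 - t) *: y) by apply: le_lt_trans le _; rewrite ltry.
by move: le; rewrite [in X in X -> _](edom_fineK fNy d) lee_fin.
Qed.

End ConvexFunctions.

Section Prox.
Context (R : realType) (H : completeNormedModType R).
Context (dot : {dot H for idfun}) (hdot : induces_norm dot).
Context (f : H -> \bar R) (fP : proper_fun f) (f_cvx : econvex f).
Context (a : R) (a0 : 0 < a) (w : H).
Let penalized v := (f v + (a / 2 * `|v - w| ^+ 2)%:E)%E.

(** Strong convexity of the penalized function makes every minimizing sequence
    Cauchy, and lower semicontinuity makes its limit a minimizer. The lower bound
    [m] plays the part of an affine minorant of [f], which a Hahn-Banach argument would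
    otherwise have to supply. *)
Lemma prox_exists (m : R) : lower_semicontinuous f ->
  (forall v, edom f v -> m <= fine (f v) + a / 2 * `|v - w| ^+ 2) ->
  argmin penalized !=set0.
Proof.
move=> f_lsc mf; have [fNy [x0 x0f]] := fP.
pose g v := fine (f v) + a / 2 * `|v - w| ^+ 2.
pose E := [set g v | v in edom f].
have Einf : has_inf E.
  by split; [exists (g x0), x0 | exists m => _ [v fv <-]; exact: mf].
have gE v : edom f v -> inf E <= g v.
  by move=> fv; apply: ge_inf; [case: Einf | exists v].
have step n : exists x, edom f x /\ g x < inf E + n.+1%:R^-1.
  have n0 : 0 < (n.+1%:R : R)^-1 by rewrite invr_gt0 ltr0n.
  by have [_ [v fv <-] lt] := inf_adherent n0 Einf; exists v.
have [x xP] := choice step.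
have cvg_inv : (fun n => (n.+1%:R : R)^-1) @ \oo --> (0 : R) by exact: cvg_harmonic.
have xcvg : cvgn x.
  apply: (@cvg_dist_sq _ _ _ (fun n => 8 / a * n.+1%:R^-1)) => [k n nk|].
    have [fk gk] := xP k; have [fn gn] := xP n.
    have h0 : 0 < (2^-1 : R) by lra.
    have h1 : (2^-1 : R) < 1 by lra.
    have [fz zle] := econvex_edom f_cvx fNy fk fn h0 h1.
    have := gE _ fz; move: gk gn zle; rewrite /g.
    (* The midpoint competes with the infimum; by the parallelogram identity it
       lies below the average of the two values by [a / 8] times the squared
       distance, whence the factor [8 / a]. *)
    set z := 2^-1 *: x k + (1 - 2^-1) *: x n.
    have -> : x k - x n = (x k - w) - (x n - w) by rewrite opprB addrA subrK.
    have -> : z - w = 2^-1 *: (x k - w) + 2^-1 *: (x n - w).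
      rewrite /z !scalerBr addrACA -opprD -scalerDl.
      by rewrite [X in X *: w](_ : _ = 1) ?scale1r; [congr (_ + _ *: _ - _); lra | lra].
    move: (x k - w) (x n - w) => X Y; rewrite -!hdot !dotE (dotC dot Y X).
    have kn : (k.+1%:R^-1 : R) <= n.+1%:R^-1 by rewrite lef_pV2 ?posrE ?ltr0n// ler_nat.
    move: kn; set rk := _^-1; set rn := _^-1 => kn gk gn zle Ele.
    by rewrite mulrAC ler_pdivlMr//; lra.
  by rewrite -[0](mulr0 (8 / a)); apply: cvgMr.
pose l := limn x; have xl : x n @[n --> \oo] --> l by [].
(* If [f l] exceeded the bound, a level [s] strictly between would separate the
   values of [f] near [l] from those along the minimizing sequence. *)
have lE : (f l + (a / 2 * `|l - w| ^+ 2)%:E <= (inf E)%:E)%E.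
  rewrite -leeBrDr// -EFinB leNgt; apply/negP => lt.
  have [s sl sf] : exists2 s : R, inf E - a / 2 * `|l - w| ^+ 2 < s & (s%:E < f l)%E.
    move: lt; case: (f l) => [r| |]// lt.
      rewrite lte_fin in lt; exists ((inf E - a / 2 * `|l - w| ^+ 2 + r) / 2).
        by lra.
      by rewrite lte_fin; lra.
    exists (inf E - a / 2 * `|l - w| ^+ 2 + 1); [lra | by rewrite ltry].
  have [V lV sV] := f_lsc _ _ sf.
  have gl : inf E + n.+1%:R^-1 - a / 2 * `|x n - w| ^+ 2 @[n --> \oo]
      --> inf E + 0 - a / 2 * `|l - w| ^+ 2.
    apply: cvgB; first by apply: cvgD => //; exact: cvg_cst.
    apply: cvgMr; rewrite expr2; under eq_fun do rewrite expr2.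
    have nl : `|x n - w| @[n --> \oo] --> `|l - w|.
      by apply: cvg_norm; apply: cvgB => //; exact: cvg_cst.
    exact: cvgM.
  rewrite addr0 in gl.
  have [N _ NP] : \forall n \near \oo, s < fine (f (x n)).
    near=> n; have [fn _] := xP n.
    have : V (x n) by near: n; exact: xl.
    by move/sV; rewrite {1}(edom_fineK fNy fn) lte_fin.
  have := cvgr_lt _ gl _ sl; move=> [N' _ N'P].
  have := NP (maxn N N') (leq_maxl _ _); have := N'P (maxn N N') (leq_maxr _ _).
  have [_] := xP (maxn N N'); move: (maxn N N') => M; rewrite /= /g.
  by move: (M.+1%:R^-1) (fine _) (a / 2 * _) (inf E) => r1 r2 r3 I; lra.
exists l => v; apply: le_trans lE _; have [fv|fv] := pselect (edom f v).
  by rewrite /penalized (edom_fineK fNy fv) -EFinD lee_fin gE.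
rewrite /penalized; move/negP: fv; rewrite -leNgt leye_eq => /eqP ->.
by rewrite addye// leey.
Unshelve. all: by end_near.
Qed.

(** The optimality condition [a * (w - p)] in the subdifferential of [f] at [p],
    obtained by moving from [p] towards [v] along the segment. *)
Lemma prox_variational p : argmin penalized p ->
  edom f p /\
  forall v, edom f v -> fine (f p) + a * dot (w - p) (v - p) <= fine (f v).
Proof.
move=> pmin; have [fNy [x0 x0f]] := fP.
have fp : edom f p.
  have := pmin x0; rewrite /penalized (edom_fineK fNy x0f) -EFinD => le.
  rewrite /edom/=; move: le (fNy p); case: (f p) => //.
split=> // v fv; rewrite -subr_le0.
apply: (@le0_of_small_mul _ _ (a / 2 * `|v - p| ^+ 2)) => t t0 t1.
have [fz zle] := econvex_edom f_cvx fNy fv fp t0 t1.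
have := pmin (t *: v + (1 - t) *: p); rewrite /penalized (edom_fineK fNy fp) (edom_fineK fNy fz).
rewrite -!EFinD lee_fin /=.
have -> : t *: v + (1 - t) *: p - w = t *: (v - p) - (w - p).
  by rewrite convex_combE opprB addrA (addrC p).
rewrite -(normrN (p - w)) opprB; move: (v - p) (w - p) zle => X Y.
rewrite -!hdot !dotE (dotC dot Y X); set z := fine _; set A := dot X X; set B := dot X Y.
move=> zle le.
have : 0 <= t * (fine (f v) - fine (f p) - a * B + t * (a / 2 * A)) by nra.
by rewrite pmulr_rge0//; lra.
Qed.

End Prox.

(** * Projections and weakly closed sets *)

Section WeakClosedness.
Context (R : realType) (H : completeNormedModType R).
Context (dot : {dot H for idfun}) (hdot : induces_norm dot).
Implicit Types (C : set H) (w x y p q l h : H).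

Definition convex_subset C := forall x y (t : R),
  C x -> C y -> 0 < t -> t < 1 -> C (t *: x + (1 - t) *: y).

Lemma closed_halfspace h (c : R) : closed [set x | dot x h <= c].
Proof.
apply: (@closed_comp _ _ (fun x => dot x h) [set y | y <= c]); last exact: closed_le.
by move=> x _; apply: cvg_dotl.
Qed.

Lemma convex_halfspace h (c : R) : convex_subset [set x | dot x h <= c].
Proof. by move=> x y t /= xc yc t0 t1; rewrite !dotE; nra. Qed.

Lemma closed_norm_le (c : R) : closed [set x : H | `|x| <= c].
Proof.
apply: (@closed_comp _ _ (fun x : H => `|x|) [set y | y <= c]); last exact: closed_le.
by move=> x _; apply: norm_continuous.
Qed.

Lemma convex_norm_le (c : R) : convex_subset [set x : H | `|x| <= c].
Proof.
move=> x y t /= xc yc t0 t1; apply: le_trans (ler_normD _ _) _.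
rewrite !normrZ !gtr0_norm//; [nra | lra].
Qed.

(** The projection is the proximal point of the indicator function of [C], so
    existence and the obtuse-angle characterization are those of [prox]. *)
Lemma projection_exists C w : closed C -> convex_subset C -> C !=set0 ->
  exists2 p, C p & forall q, C q -> dot (w - p) (q - p) <= 0.
Proof.
move=> clC cvC [x0 Cx0].
pose f x : \bar R := if x \in C then 0%E else +oo%E.
have fC x : C x -> f x = 0%E by move=> Cx; rewrite /f mem_set.
have fNC x : ~ C x -> f x = +oo%E by move=> Cx; rewrite /f memNset.
have domf x : edom f x -> C x.
  by rewrite /edom /=; have [//|/fNC ->] := pselect (C x).
have fge0 x : (0 <= f x)%E by rewrite /f; case: ifP => // _; rewrite leey.
have fP : proper_fun f.
  split=> [x|]; first by apply: lt_le_trans (fge0 x); rewrite ltNyr.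
  by exists x0; rewrite /edom /= fC// ltry.
have fcvx : econvex f.
  move=> x y t t0 t1; have [Cx|/fNC fx] := pselect (C x); last first.
    rewrite fx gt0_muley ?lte_fin// addye ?leey//.
    by rewrite -ltNye; apply: lt_le_trans (mule_ge0 _ _); rewrite ?ltNyr// lee_fin; lra.
  have [Cy|/fNC fy] := pselect (C y); last first.
    rewrite fy gt0_muley ?lte_fin ?subr_gt0// addey ?leey//.
    by rewrite -ltNye; apply: lt_le_trans (mule_ge0 _ _); rewrite ?ltNyr// lee_fin; lra.
  by rewrite !fC// ?mule0 ?adde0//; exact: cvC.
have flsc : lower_semicontinuous f.
  apply/lower_semicontinuousP => c; have [c0|c0] := ltP c 0.
    rewrite (_ : [set _ | _] = setT); first exact: openT.
    by apply/seteqP; split=> // x _ /=; apply: lt_le_trans (fge0 x); rewrite lte_fin.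
  rewrite (_ : [set _ | _] = ~` C); first exact: closed_openC.
  apply/seteqP; split=> x /=; last by move/fNC ->; rewrite ltry.
  by move=> + Cx; rewrite fC// lte_fin ltNge c0.
have two0 : 0 < (2 : R) by lra.
have [|p pmin] := @prox_exists _ _ dot hdot f fP fcvx 2 two0 w 0 flsc.
  by move=> v /domf Cv; rewrite fC//= add0r mulr_ge0 ?exprn_ge0// divr_ge0.
have [/domf Cp pv] := prox_variational hdot fP fcvx pmin.
exists p => // q Cq; have := pv q; rewrite /edom /= !fC//= ltry => /(_ isT); lra.
Qed.

(** An obtuse angle at [p] improves the triangle inequality to this half of
    Pythagoras' theorem; it is what makes projections converge. *)
Lemma sq_dist_projection w p q : dot (w - p) (q - p) <= 0 ->
  `|w - p| ^+ 2 + `|q - p| ^+ 2 <= `|w - q| ^+ 2.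
Proof.
have -> : w - q = (w - p) - (q - p) by rewrite opprB addrA subrK.
move: (w - p) (q - p) => X Y; rewrite -!hdot !dotE (dotC dot Y X); lra.
Qed.

(** [orth_proj] selects some nearest point; [sq_dist_projection] shows that it is
    the only one, so the selected point inherits the variational inequality. *)
Lemma orth_projP C w : closed C -> convex_subset C -> C !=set0 ->
  C (orth_proj C w) /\
  forall q, C q -> dot (w - orth_proj C w) (q - orth_proj C w) <= 0.
Proof.
move=> clC cvC C0; have [p Cp pv] := projection_exists w clC cvC C0.
rewrite /orth_proj; case: xgetP => [y _ [Cy yv]|/(_ p) []]; last first.
  split=> // q Cq; rewrite -(ler_pXn2r (n := 2))// ?nnegrE//.
  by have := sq_dist_projection (pv q Cq); have := exprn_ge0 2 (normr_ge0 (q - p)); lra.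
suff -> : y = p by [].
have := sq_dist_projection (pv y Cy).
have : `|w - y| ^+ 2 <= `|w - p| ^+ 2 by rewrite ler_pXn2r ?nnegrE// yv.
by move=> le1 le2; apply: sq_dist_le0; lra.
Qed.

(** With [p] the projection of [l], the variational inequality passes to the weak
    limit along [x] and reads [|l - p|^2 <= 0]. *)
Lemma closed_convex_weak_limit C (x : nat -> H) l :
  closed C -> convex_subset C -> weak_cvg dot x l ->
  (\forall k \near \oo, C (x k)) -> C l.
Proof.
move=> clC cvC xl [N _ NC].
have [|p Cp pv] := projection_exists l clC cvC; first by exists (x N); apply: NC => /=.
suff : dot (l - p) (l - p) <= 0.
  by rewrite hdot => /sq_dist_le0 ->.
rewrite [X in X <= _](_ : _ = dot l (l - p) - dot p (l - p)); last by rewrite dotDl dotNl.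
rewrite subr_le0.
suff nearC : \forall k \near \oo, dot (x k) (l - p) <= dot p (l - p).
  exact: (closed_cvg [set y | y <= dot p (l - p)] (@closed_le _ _) nearC _ (xl (l - p))).
exists N => // k Nk; have := pv _ (NC k Nk); rewrite dotC dotDl dotNl /=; lra.
Qed.

(** A substitute for weak compactness: [l] is a common point of the closed convex
    hulls of the [A n], stated through the closed convex supersets that these
    hulls are the intersections of. The projections of 0 onto the hulls have
    nondecreasing bounded norms, hence converge. *)
Lemma weak_cluster_point (A : nat -> set H) (B : R) :
  (forall n, A n !=set0) -> (forall m n, (n <= m)%N -> A m `<=` A n) ->
  (forall x, A 0%N x -> `|x| <= B) ->
  exists l, forall n C, closed C -> convex_subset C -> A n `<=` C -> C l.
Proof.
move=> A0 Adec AB.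
pose K n := \bigcap_(C in [set C | [/\ closed C, convex_subset C & A n `<=` C]]) C.
have clK n : closed (K n) by apply: closed_bigI => C [].
have cvK n : convex_subset (K n).
  by move=> x y t Kx Ky t0 t1 C CP; have [_ cvC _] := CP; apply: cvC => //; [apply: Kx | apply: Ky].
have AK n : A n `<=` K n by move=> x Ax C [_ _]; exact.
have KA m n : (n <= m)%N -> K m `<=` K n.
  by move=> nm x Kx C [clC cvC AC]; apply: Kx; split=> // y /(Adec _ _ nm)/AC.
have KB n x : K n x -> `|x| <= B.
  move=> Kx; apply: (KA n 0%N _ x Kx [set x : H | `|x| <= B]) => //; split => //.
    exact: closed_norm_le.
  exact: convex_norm_le.
have step n : exists p, K n p /\ forall q, K n q -> dot (0 - p) (q - p) <= 0.
  have [x Ax] := A0 n; have [|p Kp pv] := projection_exists 0 (clK n) (cvK n).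
    by exists x; exact: AK.
  by exists p.
have [p pP] := choice step.
have pcvg : cvgn p.
  apply: (@cvg_telescope_sq _ _ _ (fun n => - `|p n| ^+ 2) (- (B ^+ 2))) => [m n nm|n].
    have [Km _] := pP m; have [_ pv] := pP n.
    have := sq_dist_projection (pv _ (KA _ _ nm _ Km)); rewrite !sub0r !normrN; lra.
  have [Kn _] := pP n; have pB := KB n _ Kn.
  by rewrite lerN2 ler_pXn2r ?nnegrE// (le_trans _ pB).
exists (limn p) => n C clC cvC AC.
suff Kl : K n (limn p) by apply: Kl.
apply: (closed_cvg (K n) (clK n) _ (limn p) pcvg).
by exists n => // m nm; apply: (KA m n nm); have [] := pP m.
Qed.

End WeakClosedness.

(** * Linearization of the smooth part *)

Section GradientBounds.
Context (R : realType) (H : completeNormedModType R).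
Context (dot : {dot H for idfun}) (hdot : induces_norm dot).
Context (F : H -> \bar R) (gradF : H -> H) (L : R).
Hypothesis (F_C1 : C1_on_interior F) (F_grad : is_gradient dot F gradF).
Hypothesis (gradF_lip : L.-lipschitz gradF).

Lemma gradient_lipschitz x y : `|gradF x - gradF y| <= L * `|x - y|.
Proof. exact: (gradF_lip (x := (x, y)) (conj I I)). Qed.

Lemma is_derive_segment x h (t : R) : (edom F)° (x + t *: h) ->
  is_derive t 1 (fun s : R => fine (F (x + s *: h))) (dot (gradF (x + t *: h)) h).
Proof.
move=> xt; have [dF _] := F_C1 xt.
have der : is_derive (x + t *: h) h (fine \o F : H -> R^o) (dot (gradF (x + t *: h)) h).
  split; first exact: diff_derivable.
  by rewrite deriveE// F_grad.
have E : (fun s : R => s^-1 *: (fine (F (x + (s *: 1 + t) *: h)) - fine (F (x + t *: h)))) =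
    (fun s : R => s^-1 *: (fine (F (s *: h + (x + t *: h))) - fine (F (x + t *: h)))).
  apply/funext => s; congr (_ *: (fine (F _) - _)).
  by rewrite [s *: 1]mulr1 scalerDl addrCA.
by case: der => der1 der2; split; move: der1 der2; rewrite /derivable /derive /= E.
Qed.

(** The mean value theorem on the segment gives the constant [L]; the sharp
    [L / 2] would take an integration and would only improve later constants.
    Bounding the absolute value serves both the descent inequality and,
    through its lower half, the gradient inequality of convex functions. *)
Lemma linearization_error (x y : H) :
  (forall t : R, 0 <= t -> t <= 1 -> (edom F)° (x + t *: (y - x))) ->
  `|fine (F y) - fine (F x) - dot (gradF x) (y - x)| <= L * `|y - x| ^+ 2.
Proof.
move=> seg; set h := y - x.
pose phi (t : R) : R := fine (F (x + t *: h)).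
pose dphi (t : R) : R := dot (gradF (x + t *: h)) h.
have der (t : R) : t \in `[0, 1]%R -> is_derive t 1 phi (dphi t).
  by rewrite in_itv /= => /andP[t0 t1]; apply: is_derive_segment; exact: seg.
have dero (t : R) : t \in `]0, 1[%R -> is_derive t 1 phi (dphi t).
  by move=> t01; apply: der; exact: subset_itv_oo_cc t01.
have phic : {within `[0, 1], continuous phi}.
  by apply: derivable_within_continuous => t /der [].
have [c] := MVT ltr01 dero phic.
rewrite in_itv /= => /andP[c0 c1].
have -> : phi 1 = fine (F y) by rewrite /phi scale1r addrC subrK.
have -> : phi 0 = fine (F x) by rewrite /phi scale0r addr0.
rewrite subr0 mulr1 => ->; rewrite /dphi.
rewrite -dotNl -dotDl.
apply: le_trans (norm_dot_le hdot _ _) _.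
have le : `|gradF (x + c *: h) - gradF x| <= L * (c * `|h|).
  have := gradient_lipschitz (x + c *: h) x.
  by rewrite addrAC subrr add0r normrZ gtr0_norm.
have L0 : 0 <= L * `|h|.
  by apply: le_trans (gradient_lipschitz y x); exact: normr_ge0.
rewrite expr2 mulrA; apply: ler_wpM2r => //; apply: le_trans le _.
by rewrite mulrCA; nra.
Qed.

End GradientBounds.

(** * Nonmonotone descent for real sequences *)

(** Here [psi] plays the role of the objective gap and [d] that of the step
    length. The hypothesis [descent] expresses the nonmonotone test without
    mentioning the maximum: any bound [b] for a window of [M.+1] values bounds the
    next value, with a gain given by the step that leads to it. *)
Section NonmonotoneDescent.
Context (R : realType) (psi d : nat -> R) (c : R) (M : nat).
Hypothesis (c_gt0 : 0 < c) (psi_ge0 : forall k, 0 <= psi k).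
Hypothesis descent : forall k b, (forall j, (j <= M)%N -> psi (k + j)%N <= b) ->
  psi (k + M.+1)%N <= b - c * d (k + M)%N ^+ 2.

Definition window k := \big[Num.max/0]_(j < M.+1) psi (k + j)%N.

Lemma window_ge0 k : 0 <= window k.
Proof. by rewrite /window; elim/big_ind: _ => // x y x0 y0; rewrite le_max x0. Qed.

Lemma le_window k j : (j <= M)%N -> psi (k + j)%N <= window k.
Proof. by rewrite -ltnS => jM; exact: (le_bigmax _ _ (Ordinal jM)). Qed.

Lemma window_le k b : (forall j, (j <= M)%N -> psi (k + j)%N <= b) -> window k <= b.
Proof.
move=> hb; apply: bigmax_le => [|j _]; last by apply: hb; rewrite -ltnS.
by apply: le_trans (hb 0%N isT).
Qed.

(** Each value is below the maximum of the window just before it, so a bound on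
    one window propagates to everything after it. *)
Lemma tail_le_window k n : psi (k + n)%N <= window k.
Proof.
elim/ltn_ind: n => n IH; have [/le_window//|Mn] := leqP n M.
have -> : (k + n = (k + (n - M.+1)) + M.+1)%N by lia.
apply: le_trans (descent (b := window k) _) _.
  by move=> j jM; rewrite -addnA; apply: IH; lia.
by rewrite gerBl mulr_ge0 ?sqr_ge0// ltW.
Qed.

Lemma window_nonincreasing m n : (m <= n)%N -> window n <= window m.
Proof.
move=> mn; apply: window_le => j _.
have -> : (n + j = m + (n - m + j))%N by lia.
exact: tail_le_window.
Qed.

(** The window maxima are nonincreasing and their sum is at most [M.+1] times
    that of [psi]; hence [n] times the [n]-th maximum is at most the sum of the
    first [n] ones. *)
Lemma nonmonotone_rate (B : R) : (forall n, \sum_(k < n) psi k <= B) ->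
  forall n, n%:R * psi n <= M.+1%:R * B.
Proof.
move=> psiB n.
have shifted j : \sum_(k < n) psi (k + j)%N <= B.
  apply: le_trans (psiB (j + n)%N).
  rewrite big_split_ord /= [X in _ <= _ + X](eq_bigr (fun k : 'I_n => psi (k + j)%N)).
    by rewrite lerDr sumr_ge0.
  by move=> k _; rewrite addnC.
have windowB : \sum_(k < n) window k <= M.+1%:R * B.
  apply: (@le_trans _ _ (\sum_(k < n) \sum_(j < M.+1) psi (k + j)%N)).
    apply: ler_sum => k _; apply: window_le => j; rewrite -ltnS => jM.
    by rewrite (bigD1 (Ordinal jM)) //= lerDl sumr_ge0.
  rewrite exchange_big /= mulr_natl.
  by rewrite -[X in _ *+ X](card_ord M.+1) -sumr_const; apply: ler_sum.
apply: le_trans windowB.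
rewrite mulr_natl -[X in _ *+ X](card_ord n) -sumr_const; apply: ler_sum => k _.
apply: le_trans (window_nonincreasing (ltnW (ltn_ord k))).
by have := le_window n (leq0n M); rewrite addn0.
Qed.

Context (C : R) (C_ge1 : 1 <= C).
Hypothesis (d_ge0 : forall k, 0 <= d k) (ratio : forall k, d k.+1 <= C * d k).

(** The values indexed from [k + M.+1] to [k + M + M.+1] are reached by the steps
    [k + M], ..., [k + M + M]. By [ratio], all of these are at least
    [C ^- M] times the last one, so every value of the new window gains a common
    multiple of its square. *)
Lemma window_decrease k :
  window (k + M.+1) <= window k - c / C ^+ M ^+ 2 * d (k + M + M)%N ^+ 2.
Proof.
have C_gt0 : 0 < C := lt_le_trans ltr01 C_ge1.
apply: window_le => j jM.
have -> : (k + M.+1 + j = k + j + M.+1)%N by lia.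
apply: le_trans (descent (b := window k) _) _.
  by move=> i _; rewrite -addnA; exact: tail_le_window.
have growth n i : d (n + i)%N <= C ^+ i * d n.
  elim: i => [|i IH]; first by rewrite addn0 expr0 mul1r.
  rewrite addnS exprS -mulrA; apply: le_trans (ratio _) _.
  by rewrite ler_wpM2l// ltW.
rewrite lerD2l lerN2 -mulrA ler_pM2l//.
rewrite mulrC ler_pdivrMr ?exprn_gt0// -exprMn.
rewrite ler_pXn2r ?nnegrE ?mulr_ge0// ?exprn_ge0 ?(ltW C_gt0)//.
have -> : (k + M + M = k + j + M + (M - j))%N by lia.
apply: le_trans (growth _ _) _; rewrite mulrC ler_wpM2l//.
by apply: ler_weXn2l => //; rewrite leq_subr.
Qed.

(** The decreases compare windows at distance [M.+1], so the sum of differences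
    telescopes up to [M.+1] initial terms instead of one. *)
Lemma sum_sq_bounded : exists B, forall n, \sum_(k < n) d k ^+ 2 <= B.
Proof.
have C_gt0 : 0 < C := lt_le_trans ltr01 C_ge1.
pose c' := c / C ^+ M ^+ 2.
have c'0 : 0 < c' by rewrite divr_gt0// !exprn_gt0.
have telescope n : \sum_(k < n) (window k - window (k + M.+1)) =
    \sum_(k < M.+1) window k - \sum_(k < M.+1) window (n + k).
  elim: n => [|n IH]; first by rewrite big_ord0 subrr.
  rewrite big_ord_recr /= {}IH -addrA; congr (_ + _).
  rewrite [X in _ = - X]big_ord_recr [X in - X + _]big_ord_recl /= addn0 addSnnS.
  under eq_bigr do rewrite /bump leq0n add1n -addSnnS.
  by lra.
exists (\sum_(k < M + M) d k ^+ 2 + (\sum_(k < M.+1) window k) / c') => n.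
have tail : \sum_(k < n) d (M + M + k)%N ^+ 2 <= (\sum_(k < M.+1) window k) / c'.
  rewrite ler_pdivlMr// mulr_suml.
  apply: (@le_trans _ _ (\sum_(k < n) (window k - window (k + M.+1)))).
    apply: ler_sum => k _; have := window_decrease k; rewrite -/c' mulrC.
    have -> : (M + M + k = k + M + M)%N by lia.
    by lra.
  by rewrite telescope gerBl sumr_ge0// => k _; exact: window_ge0.
apply: (@le_trans _ _ (\sum_(k < M + M + n) d k ^+ 2)).
  rewrite [(M + M + n)%N]addnC big_split_ord /= lerDl.
  by rewrite sumr_ge0// => k _; exact: exprn_ge0.
by rewrite big_split_ord /= lerD2l.
Qed.

End NonmonotoneDescent.

(** * Quasi-Fejer monotone sequences *)

(** [E n] is the total error so far: [|x n - v|^2 - E n] is nonincreasing for each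
    [v] in [S]. The hypothesis [cluster] says that weak cluster points of [x]
    belong to [S], in terms of the closed convex sets that contain a tail of [x],
    which is how both weak limits and the points of [weak_cluster_point] are
    detected. *)
Section QuasiFejer.
Context (R : realType) (H : completeNormedModType R).
Context (dot : {dot H for idfun}) (hdot : induces_norm dot).
Context (S : set H) (S_closed : closed S) (S_convex : convex_subset S) (S_neq0 : S !=set0).
Context (x : nat -> H) (E : nat -> R) (B : R).
Hypothesis (E_ge0 : forall n, 0 <= E n) (E_le : forall n, E n <= B).
Hypothesis fejer : forall v m n, S v -> (n <= m)%N ->
  `|x m - v| ^+ 2 - E m <= `|x n - v| ^+ 2 - E n.
Hypothesis cluster : forall l,
  (forall C, closed C -> convex_subset C -> (\forall k \near \oo, C (x k)) -> C l) ->
  S l.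

Let P k := orth_proj S (x k).

Let PS k : S (P k).
Proof. by have [] := orth_projP hdot (x k) S_closed S_convex S_neq0. Qed.

Let Pvar k v : S v -> dot (x k - P k) (v - P k) <= 0.
Proof. by have [_] := orth_projP hdot (x k) S_closed S_convex S_neq0; apply. Qed.

Lemma quasi_fejer_bounded v : S v -> exists D, forall k, `|x k - v| <= D.
Proof.
move=> Sv; exists (`|x 0%N - v| ^+ 2 + B + 1) => k.
have := fejer Sv (leq0n k); have := E_ge0 0%N; have := E_le k.
have := sqr_ge0 (`|x k - v| - 1); rewrite sqrrB expr1n mulr1.
by have := sqr_ge0 (`|x k - v|); have := normr_ge0 (x k - v); lra.
Qed.

(** The obtuse angle at [P m] bounds [|P m - P n|^2] by
    [|x m - P n|^2 - |x m - P m|^2], and the Fejer inequality at [P n] turns this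
    into a difference of values of [|x n - P n|^2 - E n]. *)
Lemma quasi_fejer_proj_cvg : cvgn P.
Proof.
apply: (@cvg_telescope_sq _ _ _ (fun n => `|x n - P n| ^+ 2 - E n) (- B)) => [m n nm|n].
  have := sq_dist_projection hdot (Pvar m (PS n)).
  have := fejer (PS n) nm; rewrite -(normrN (P n - P m)) opprB; lra.
by have := E_le n; have := exprn_ge0 2 (normr_ge0 (x n - P n)); lra.
Qed.

Lemma quasi_fejer_lim_mem : S (limn P).
Proof.
by apply: (closed_cvg S S_closed _ _ quasi_fejer_proj_cvg); exists 0%N => // k _; exact: PS.
Qed.

(** Up to an error that vanishes with [|P k - limn P|], this is the variational
    inequality [dot (x k - P k) (l - P k) <= 0]. *)
Lemma quasi_fejer_dot_le l e : S l -> 0 < e ->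
  \forall k \near \oo, dot (x k) (l - limn P) <= dot (limn P) (l - limn P) + e.
Proof.
set z := limn P => Sl e0; have [D xD] := quasi_fejer_bounded Sl.
have D0 : 0 <= D by exact: le_trans (xD 0%N).
have K0 : 0 < D + `|l - z| + 1 by rewrite ltr_wpDl// addr_ge0.
have /cvgrPdist_lt/(_ _ (divr_gt0 e0 K0))[N _ NP] : P n @[n --> \oo] --> z.
  exact: quasi_fejer_proj_cvg.
exists N => // k Nk; have := NP k Nk; rewrite /= ltr_pdivlMr// distrC => Pz.
have xPD : `|x k - P k| <= D.
  apply: le_trans (xD k); rewrite -(ler_pXn2r (n := 2))// ?nnegrE//.
  have := sq_dist_projection hdot (Pvar k Sl).
  by have := exprn_ge0 2 (normr_ge0 (l - P k)); lra.
have h1 := Pvar k Sl.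
have h2 := dot_le_norm hdot (x k - P k) (P k - z).
have h3 := dot_le_norm hdot (P k - z) (l - z).
have h4 := ler_wpM2r (normr_ge0 (P k - z)) xPD.
have : dot (x k) (l - z) - dot z (l - z) = dot (x k - P k) (l - P k)
    + dot (x k - P k) (P k - z) + dot (P k - z) (l - z).
  by rewrite !dotE; lra.
by have := normr_ge0 (P k - z); lra.
Qed.

(** If the inequality failed infinitely often, [weak_cluster_point] applied to the
    offending tails would give a point [l] of [S] with
    [dot l h >= dot (limn P) h + e]. But [quasi_fejer_dot_le] places these tails
    in half-spaces that force [|l - limn P|^2 <= 0]. *)
Lemma quasi_fejer_weak_lt h e : 0 < e ->
  \forall k \near \oo, dot (x k) h < dot (limn P) h + e.
Proof.
set z := limn P => e0; apply: contrapT => often.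
pose A n := [set y | exists k, [/\ (n <= k)%N, y = x k & dot z h + e <= dot (x k) h]].
have A0 n : A n !=set0.
  apply: contrapT => An0; apply: often; exists n => // k nk /=.
  by rewrite ltNge; apply/negP => hk; apply: An0; exists (x k), k.
have Adec m n : (n <= m)%N -> A m `<=` A n.
  by move=> nm _ [k [mk -> hk]]; exists k; split=> //; exact: leq_trans mk.
have [v Sv] := S_neq0; have [D xD] := quasi_fejer_bounded Sv.
have AB y : A 0%N y -> `|y| <= D + `|v|.
  move=> [k [_ -> _]]; rewrite -[x k](subrK v).
  by apply: le_trans (ler_normD _ _) _; rewrite lerD2r.
have [l lA] := weak_cluster_point hdot A0 Adec AB.
have Sl : S l.
  apply: cluster => C clC cvC [N _ NC]; apply: (lA N) => // _ [k [Nk -> _]].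
  exact: NC.
have lh : dot z h + e <= dot l h.
  have : dot l (- h) <= - (dot z h + e).
    apply: (lA 0%N [set y | dot y (- h) <= - (dot z h + e)]).
    - exact: closed_halfspace.
    - exact: convex_halfspace.
    - by move=> _ [k [_ -> hk]] /=; rewrite dotNr lerN2.
  by rewrite dotNr lerN2.
have lz : dot (l - z) (l - z) <= 0.
  apply/ler_addgt0Pr => eps eps0; rewrite add0r; have [N _ NP] := quasi_fejer_dot_le Sl eps0.
  have : dot l (l - z) <= dot z (l - z) + eps.
    apply: (lA N [set y | dot y (l - z) <= dot z (l - z) + eps]).
    - exact: closed_halfspace.
    - exact: convex_halfspace.
    - by move=> _ [k [Nk -> _]]; exact: NP.
  by rewrite dotDl dotNl; lra.
move: lh; suff -> : l = z by lra.
by move: lz; rewrite hdot => /sq_dist_le0.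
Qed.

Lemma quasi_fejer_weak_cvg : weak_cvg dot x (limn P).
Proof.
move=> h; apply/cvgrPdist_lt => e e0; near=> k; rewrite ltr_norml; apply/andP; split.
  suff : dot (x k) h < dot (limn P) h + e by lra.
  by near: k; exact: quasi_fejer_weak_lt.
suff : dot (x k) (- h) < dot (limn P) (- h) + e by rewrite !dotNr; lra.
by near: k; exact: quasi_fejer_weak_lt.
Unshelve. all: by end_near.
Qed.

End QuasiFejer.

(** * The composite problem and the forward-backward step *)

Section CompositeProblem.
Context (R : realType) (H : completeNormedModType R).
Context (dot : {dot H for idfun}) (hdot : induces_norm dot).
Context (F Reg : H -> \bar R) (gradF : H -> H) (L : R).
Hypothesis (Reg_proper : proper_fun Reg) (Reg_convex : econvex Reg).
Hypothesis (Reg_lsc : lower_semicontinuous Reg).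
Hypothesis (F_gtNy : forall u, (-oo < F u)%E) (F_convex : econvex F).
Hypothesis (F_C1 : C1_on_interior F) (F_dom : edom Reg `<=` (edom F)°).
Hypothesis (F_grad : is_gradient dot F gradF).
Hypothesis (L_gt0 : 0 < L) (gradF_lip : L.-lipschitz gradF).
Implicit Types (x y v p q : H) (a b t c : R).

Local Notation Psi := (objective F Reg).
Local Notation S := (stationary dot gradF Reg).

(** The real value of the objective, faithful only on the domain of [Reg]. *)
Definition robjective x := fine (F x) + fine (Reg x).
Local Notation psi := robjective.

Let Reg_gtNy : forall u, (-oo < Reg u)%E := Reg_proper.1.

Lemma dom_F x : edom Reg x -> edom F x.
Proof. by move=> /F_dom; exact: interior_subset. Qed.

Lemma objectiveE x : edom Reg x -> Psi x = (psi x)%:E.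
Proof.
move=> xd; rewrite /objective (edom_fineK F_gtNy (dom_F xd)).
by rewrite (edom_fineK Reg_gtNy xd).
Qed.

Lemma objective_out x : ~ edom Reg x -> Psi x = +oo%E.
Proof.
move/negP; rewrite -leNgt leye_eq => /eqP xd.
by rewrite /objective xd addey// -ltNye.
Qed.

Lemma dom_segment x y t : edom Reg x -> edom Reg y -> 0 <= t -> t <= 1 ->
  edom Reg (x + t *: (y - x)).
Proof.
move=> xd yd; rewrite le_eqVlt => /predU1P[<- _|t0]; first by rewrite scale0r addr0.
rewrite le_eqVlt => /predU1P[->|t1]; first by rewrite scale1r addrC subrK.
have [+ _] := econvex_edom Reg_convex Reg_gtNy yd xd t0 t1.
by rewrite convex_combE.
Qed.

Lemma smooth_error x y : edom Reg x -> edom Reg y ->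
  `|fine (F y) - fine (F x) - dot (gradF x) (y - x)| <= L * `|y - x| ^+ 2.
Proof.
move=> xd yd; apply: (linearization_error hdot F_C1 F_grad gradF_lip) => t t0 t1.
by apply: F_dom; exact: dom_segment.
Qed.

Lemma gradient_inequality x y : edom Reg x -> edom Reg y ->
  fine (F x) + dot (gradF x) (y - x) <= fine (F y).
Proof.
move=> xd yd; rewrite -subr_le0; apply: (@le0_of_small_mul _ _ (L * `|y - x| ^+ 2)) => t t0 t1.
have [_] := econvex_edom F_convex F_gtNy (dom_F yd) (dom_F xd) t0 t1.
have := smooth_error xd (dom_segment xd yd (ltW t0) (ltW t1)).
rewrite convex_combE [_ + _ - x]addrAC subrr add0r normrZ gtr0_norm// dotZr.
move=> /ler_normlP[le _] le'.
have : t * (fine (F x) + dot (gradF x) (y - x) - fine (F y)) <=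
    t * (t * (L * `|y - x| ^+ 2)) by move: le; rewrite exprMn; lra.
by rewrite ler_pM2l.
Qed.

Lemma stationary_dom v : S v -> edom Reg v.
Proof.
move=> Sv; have [_ [x xd]] := Reg_proper; have := Sv x.
rewrite (edom_fineK Reg_gtNy xd) /edom /= => le.
by move: le (Reg_gtNy v); case: (Reg v) => // r _ _; rewrite ltry.
Qed.

Lemma stationaryE v : S v <-> edom Reg v /\
  forall y, edom Reg y -> fine (Reg v) - dot (gradF v) (y - v) <= fine (Reg y).
Proof.
split=> [Sv|[vd vy] y].
  split; first exact: stationary_dom.
  move=> y yd; have := Sv y; rewrite (edom_fineK Reg_gtNy yd).
  by rewrite (edom_fineK Reg_gtNy (stationary_dom Sv)) -EFinD lee_fin dotNl.
have [yd|/negP] := pselect (edom Reg y); last first.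
  by rewrite -leNgt leye_eq => /eqP ->; rewrite leey.
rewrite (edom_fineK Reg_gtNy yd) (edom_fineK Reg_gtNy vd) -EFinD lee_fin dotNl.
exact: vy.
Qed.

Lemma argmin_dom v : argmin Psi v -> edom Reg v.
Proof.
move=> vmin; have [_ [x xd]] := Reg_proper; apply: contrapT => nd.
by have := vmin x; rewrite objective_out// objectiveE// leye_eq.
Qed.

(** From left to right, the subgradient inequality of [Reg] and the gradient
    inequality of [F] add up. Conversely, on a segment issued from a minimizer the
    increment of [F] is its linear part up to a quadratic term in [t]. *)
Lemma stationary_argmin v : S v <-> argmin Psi v.
Proof.
split=> [/stationaryE[vd vy] y|vmin].
  have [yd|yd] := pselect (edom Reg y); last by rewrite (objective_out yd) leey.
  rewrite !objectiveE// lee_fin /robjective.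
  by have := vy y yd; have := gradient_inequality vd yd; lra.
have vd := argmin_dom vmin; apply/stationaryE; split => // y yd.
rewrite -subr_le0; apply: (@le0_of_small_mul _ _ (L * `|y - v| ^+ 2)) => t t0 t1.
have zd := dom_segment vd yd (ltW t0) (ltW t1).
have := vmin (v + t *: (y - v)); rewrite !objectiveE// lee_fin /robjective.
have := smooth_error vd zd.
have [_] := econvex_edom Reg_convex Reg_gtNy yd vd t0 t1.
rewrite convex_combE [_ + _ - v]addrAC subrr add0r normrZ gtr0_norm// dotZr.
move=> le1 /ler_normlP[_ le2] le3.
have : t * (fine (Reg v) - dot (gradF v) (y - v) - fine (Reg y)) <=
    t * (t * (L * `|y - v| ^+ 2)) by move: le2; rewrite exprMn; lra.
by rewrite ler_pM2l.
Qed.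

Lemma convex_sublevel c : convex_subset [set x | (Psi x <= c%:E)%E].
Proof.
have dom x : (Psi x <= c%:E)%E -> edom Reg x.
  by move=> xc; apply: contrapT => /objective_out E; move: xc; rewrite E leye_eq.
move=> x y t /= xc yc t0 t1; have xd := dom _ xc; have yd := dom _ yc.
move: xc yc; rewrite (objectiveE xd) (objectiveE yd) !lee_fin /robjective => xc yc.
have [zd Rz] := econvex_edom Reg_convex Reg_gtNy xd yd t0 t1.
have [_ Fz] := econvex_edom F_convex F_gtNy (dom_F xd) (dom_F yd) t0 t1.
rewrite objectiveE// lee_fin /robjective; nra.
Qed.

(** Near a point of the domain, [F] is continuous and [Reg] lower semicontinuous.
    Near a point outside, [F] could be ill-behaved, but it has the affine minorant
    given by its gradient at a point of the domain, while [Reg] is large. *)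
Lemma closed_sublevel c : closed [set x | (Psi x <= c%:E)%E].
Proof.
rewrite -openC openE => x /= /negP; rewrite -ltNge => cx.
suff : \forall y \near x, (c%:E < Psi y)%E.
  by apply: filterS => y cy /=; apply/negP; rewrite -ltNge.
have [xd|xd] := pselect (edom Reg x).
  move: cx; rewrite objectiveE// lte_fin => cx.
  pose e := (psi x - c) / 2; have e0 : 0 < e by rewrite /e; lra.
  have [dF _] := F_C1 (F_dom xd).
  have /cvgrPdist_lt/(_ e e0) Fcont := differentiable_continuous dF.
  have [|V xV VP] := Reg_lsc (x := x) (a := fine (Reg x) - e).
    by rewrite [X in (_ < X)%E](edom_fineK Reg_gtNy xd) lte_fin; lra.
  near=> y.
  have [yd|/objective_out ->] := pselect (edom Reg y); last by rewrite ltry.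
  rewrite objectiveE// lte_fin /robjective.
  have : `|fine (F x) - fine (F y)| < e by near: y.
  have /VP : V y by near: y.
  rewrite {1}(edom_fineK Reg_gtNy yd) lte_fin => ry /ltr_normlP[_].
  by move: ry; rewrite /e /robjective; lra.
have [_ [x0 x0d]] := Reg_proper.
pose m := fine (F x0) - `|gradF x0| * (`|x - x0| + 1).
have Rx : Reg x = +oo%E by move/negP: xd; rewrite -leNgt leye_eq => /eqP.
have [|V xV VP] := Reg_lsc (x := x) (a := c - m); first by rewrite Rx ltry.
near=> y.
have [yd|/objective_out ->] := pselect (edom Reg y); last by rewrite ltry.
rewrite objectiveE// lte_fin /robjective.
have /VP : V y by near: y.
rewrite {1}(edom_fineK Reg_gtNy yd) lte_fin => ry.
have xy : `|x - y| < 1.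
  by near: y; have := nbhsx_ballx x 1 ltr01; rewrite -ball_normE.
have yx0 : `|y - x0| <= `|x - x0| + 1.
  have -> : y - x0 = (x - x0) - (x - y) by rewrite opprB [RHS]addrC addrA subrK.
  by apply: le_trans (ler_normB _ _) _; rewrite lerD2l ltW.
have := ler_wpM2l (normr_ge0 (gradF x0)) yx0.
have := gradient_inequality x0d yd.
have := norm_dot_le hdot (gradF x0) (y - x0) => /ler_normlP[le1 _].
by move: ry; rewrite /m; lra.
Unshelve. all: by end_near.
Qed.

Hypothesis S_neq0 : S !=set0.

(** A stationary point provides the affine minorant of [Reg] that makes the
    proximal subproblem bounded below; completing the square gives the bound. *)
Lemma fb_stepP a x : 0 < a -> let p := fb_step gradF Reg a x in
  edom Reg p /\ forall v, edom Reg v ->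
    fine (Reg p) + dot (a *: (x - p) - gradF x) (v - p) <= fine (Reg v).
Proof.
move=> a0 p; have [v0 /stationaryE[v0d v0P]] := S_neq0.
set w := x - a^-1 *: gradF x.
have pmin : argmin (fun v : H => (Reg v + (a / 2 * `|v - w| ^+ 2)%:E)%E) p.
  suff [q qmin] : argmin (fun v : H => (Reg v + (a / 2 * `|v - w| ^+ 2)%:E)%E) !=set0.
    exact: (xgetPex 0 (ex_intro _ q qmin)).
  pose g := gradF v0.
  apply: (prox_exists hdot Reg_proper Reg_convex a0 (m := fine (Reg v0)
     - dot g (w - v0) - dot g g / (2 * a)) Reg_lsc) => v vd.
  have := v0P v vd; have := dot_ge0 hdot (g - a *: (v - w)).
  have -> : v - v0 = (v - w) + (w - v0) by rewrite addrA subrK.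
  rewrite -/g -!hdot [dot g (v - w + _)]dotDr.
  move: (v - w) (w - v0) => X Y; rewrite !dotE (dotC dot X g) => le1 le2.
  have : dot g g / (2 * a) + a / 2 * dot X X - dot g X =
    (dot g g - a * dot g X - (a * dot g X - a * (a * dot X X))) / (2 * a) by field; lra.
  move=> E; have : 0 <= dot g g / (2 * a) + a / 2 * dot X X - dot g X.
    by rewrite E divr_ge0//; lra.
  lra.
have [pd pv] := prox_variational hdot Reg_proper Reg_convex pmin.
split=> // v vd; have := pv v vd; rewrite /w !dotE mulrBr.
have : a * (a^-1 * dot (gradF x) v) = dot (gradF x) v by rewrite mulrA divff ?mul1r; lra.
have : a * (a^-1 * dot (gradF x) p) = dot (gradF x) p by rewrite mulrA divff ?mul1r; lra.
by lra.
Qed.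

Lemma fb_step_dom a x : 0 < a -> edom Reg (fb_step gradF Reg a x).
Proof. by move=> a0; have [] := fb_stepP x a0. Qed.

Lemma fb_step_decrease a x : 0 < a -> edom Reg x ->
  psi (fb_step gradF Reg a x) <=
    psi x - (a - L) * `|x - fb_step gradF Reg a x| ^+ 2.
Proof.
set p := fb_step gradF Reg a x => a0 xd; have [pd /(_ x xd)] := fb_stepP x a0; rewrite -/p in pd *.
have /ler_normlP[_] := smooth_error xd pd.
rewrite -(normrN (p - x)) -(opprB x p) opprK /robjective.
by move: (x - p) => X; rewrite -!hdot !dotE; lra.
Qed.

(** With [p] and [q] the two successive points, testing the optimality condition of
    each with the other and adding leaves
    [b * |q - p|^2 <= dot (a * (p - x) - (gradF p - gradF x)) (q - p)]. *)
Lemma fb_step_ratio a b x : 0 < a -> 0 < b ->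
  b * `|fb_step gradF Reg b (fb_step gradF Reg a x) - fb_step gradF Reg a x| <=
    (a + L) * `|fb_step gradF Reg a x - x|.
Proof.
set p := fb_step gradF Reg a x => a0 b0; set q := fb_step gradF Reg b p.
have [pd pv] := fb_stepP x a0; have [qd qv] := fb_stepP p b0.
rewrite -/p in pd pv; rewrite -/q in qd qv.
have := pv q qd; have := qv p pd => le1 le2.
have lip : `|gradF p - gradF x| <= L * `|p - x| := gradient_lipschitz gradF_lip p x.
have cs1 := dot_le_norm hdot (p - x) (q - p).
have cs2 := dot_le_norm hdot (- (gradF p - gradF x)) (q - p).
have E : b * `|q - p| ^+ 2 <= a * dot (p - x) (q - p) + dot (- (gradF p - gradF x)) (q - p).
  move: le1 le2; rewrite -hdot -(opprB p x) -(opprB q p).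
  by move: (p - x) (q - p) => X Y; rewrite !dotE; lra.
rewrite normrN in cs2.
have lip2 := ler_wpM2r (normr_ge0 (q - p)) lip.
have cs1a := ler_wpM2l (ltW a0) cs1.
have : `|q - p| * (b * `|q - p|) <= `|q - p| * ((a + L) * `|p - x|) by move: E; lra.
have [->|qp] := eqVneq (q - p) 0; last by rewrite ler_pM2l// normr_gt0.
by rewrite normr0 mulr0 => _; rewrite mulr_ge0// addr_ge0 ?ltW.
Qed.

(** The optimality condition of the step tested at [v], the gradient inequality of
    [F] between [x] and [v], and the error of linearization between [x] and the
    new point add up; the remaining inner product [dot (x - p) (v - p)] is
    expanded into squares by polarization. *)
Lemma fb_step_fejer a x v : 0 < a -> edom Reg x -> edom Reg v ->
  psi (fb_step gradF Reg a x) - psi v <=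
    a / 2 * (`|x - v| ^+ 2 - `|fb_step gradF Reg a x - v| ^+ 2)
    + (L - a / 2) * `|x - fb_step gradF Reg a x| ^+ 2.
Proof.
set p := fb_step gradF Reg a x => a0 xd vd.
have [pd /(_ v vd)] := fb_stepP x a0; rewrite -/p in pd *.
have /ler_normlP[_] := smooth_error xd pd.
have := gradient_inequality xd vd.
rewrite -(normrN (p - x)) (opprB p x) /robjective.
have -> : x - v = (x - p) + (p - v) by rewrite addrA subrK.
have -> : p - x = - (x - p) by rewrite opprB.
have -> : v - x = - (p - v) - (x - p) by rewrite !opprB addrA subrK.
have -> : v - p = - (p - v) by rewrite opprB.
move: (x - p) (p - v) => X Y; rewrite -!hdot !dotE (dotC dot Y X); lra.
Qed.

(** * Runs of the algorithm *)

Section Run.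
Context (delta : R) (delta_gt0 : 0 < delta) (delta_lt1 : delta < 1).
Context (mmax : nat) (eta : R) (eta_gt1 : 1 < eta).
Context (alpha_inf alpha_sup : R) (alpha_inf_gt0 : 0 < alpha_inf).
Context (alpha_inf_sup : alpha_inf < alpha_sup).
Context (alpha_init : R) (u : nat -> H) (alpha alphaBB : nat -> R) (i : nat -> nat).
Hypothesis run : splitting_run dot F gradF Reg delta mmax eta alpha_inf alpha_sup
  alpha_init u alpha alphaBB i.

Let x k := u k.+1.

Lemma alpha_ge_inf k : alpha_inf <= alpha k.
Proof.
rewrite (run_alpha run) -[X in X <= _]mulr1; apply: ler_pM => //.
- exact: ltW.
- by rewrite le_max lexx.
- by apply: exprn_ege1; exact: ltW.
Qed.

Lemma alpha_gt0 k : 0 < alpha k.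
Proof. exact: lt_le_trans (alpha_ge_inf k). Qed.

Lemma iterate_dom k : edom Reg (x k).
Proof.
by rewrite /x (run_step run); exact: fb_step_dom (alpha_gt0 k).
Qed.

Lemma memoryE (m k : nat) : memory m k = minn k m.
Proof. by elim: k => [|k IH] /=; rewrite ?min0n // IH; lia. Qed.

Lemma window_max_le k b :
  (forall j, (j <= mmax)%N -> psi (x (k + j)) <= b) ->
  (window_max Psi mmax u (k + mmax).+1 <= b%:E)%E.
Proof.
move=> xb; rewrite /window_max memoryE big_mkord.
apply: bigmax_le => [|[j jM] _] /=; first by rewrite leNye.
have -> : ((k + mmax).+1 - j)%N = (k + (mmax - j)).+1 by lia.
rewrite [Psi _](objectiveE (iterate_dom (k + (mmax - j)))) lee_fin.
by apply: xb; rewrite leq_subr.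
Qed.

Lemma sq_gradient_mapping a y : 0 < a ->
  delta / a * `|gradient_mapping gradF Reg a y| ^+ 2 =
  delta * a * `|y - fb_step gradF Reg a y| ^+ 2.
Proof.
by move=> a0; rewrite /gradient_mapping normrZ gtr0_norm// exprMn; field; lra.
Qed.

(** The step decreases the objective by [(a - L) * |x - p|^2], while the test asks
    for [delta * a * |x - p|^2] below a maximum that includes the current
    value. *)
Lemma accepted_large a k : 0 < a -> L <= a * (1 - delta) ->
  accepted F gradF Reg delta mmax u k.+1 a.
Proof.
move=> a0 aL; have xd := iterate_dom k.
have pd := fb_step_dom (x k) a0.
have le1 : (Psi (x k) <= window_max Psi mmax u k.+1)%E.
  by rewrite /window_max big_nat_recl // subn0 le_max lexx.
rewrite /accepted sq_gradient_mapping//; apply: le_trans (leeB le1 (lexx _)).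
rewrite (objectiveE xd) (objectiveE pd) -EFinB lee_fin.
apply: le_trans (fb_step_decrease a0 xd) _ => //.
rewrite lerD2l lerN2; apply: ler_wpM2r; first exact: exprn_ge0.
by lra.
Qed.

(** If backtracking occurred, the previous trial [alpha k.+1 / eta] was rejected,
    so it is below the threshold of [accepted_large]. *)
Lemma alpha_bounded k : alpha k.+1 <= Num.max alpha_sup (eta * (L / (1 - delta))).
Proof.
have base0 : 0 < Num.max alpha_inf (Num.min alpha_sup (alphaBB k.+1)).
  by rewrite lt_max alpha_inf_gt0.
have eta0 : 0 < eta := lt_trans ltr01 eta_gt1.
have := run_smallest run (k := k.+1); rewrite (run_alpha run).
case: (i k.+1) => [_|j /(_ j (ltnSn j))].
  by rewrite expr0 mulr1 le_max ge_max (ltW alpha_inf_sup) ge_min lexx.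
set b := Num.max alpha_inf _ in base0 * => rejected.
have a0 : 0 < b * eta ^+ j by rewrite mulr_gt0// exprn_gt0.
have [aL|aL] := leP L (b * eta ^+ j * (1 - delta)).
  by case: rejected; exact: accepted_large.
by rewrite le_max exprS mulrCA ler_pM2l// ler_pdivlMr ?subr_gt0// (ltW aL) orbT.
Qed.

(** The window of iteration [(k + mmax).+1] consists of [x k], ..., [x (k + mmax)]:
    the full memory is available there and the starting point [u 0], whose value
    may be infinite, has left the window. *)
Lemma iterate_descent k b :
  (forall j, (j <= mmax)%N -> psi (x (k + j)) <= b) ->
  psi (x (k + mmax.+1)) <=
    b - delta * alpha_inf * `|x (k + mmax).+1 - x (k + mmax)| ^+ 2.
Proof.
move=> xb; have := run_accepted run (k + mmax).+1.
rewrite /accepted sq_gradient_mapping ?alpha_gt0// -(run_step run).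
rewrite (objectiveE (iterate_dom _)).
move=> /le_trans/(_ (leeB (window_max_le xb) (lexx _))).
rewrite -EFinB lee_fin addnS => /le_trans; apply.
rewrite lerD2l lerN2 -/(x (k + mmax).+1) -/(x (k + mmax)).
rewrite -(normrN (x (k + mmax) - _)) opprB; apply: ler_wpM2r; first exact: exprn_ge0.
by rewrite ler_pM2l// alpha_ge_inf.
Qed.

Let A := Num.max alpha_sup (eta * (L / (1 - delta))).
Let d k := `|x k.+1 - x k|.

Let A_gt0 : 0 < A.
Proof. by rewrite lt_max (lt_trans alpha_inf_gt0 alpha_inf_sup). Qed.

(** In [fb_step_ratio] the safeguard [alpha_inf] bounds the new step parameter from
    below and [alpha_bounded] the old one from above. *)
Lemma iterate_ratio k : d k.+1 <= (A + L) / alpha_inf * d k.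
Proof.
rewrite mulrAC ler_pdivlMr// mulrC.
apply: le_trans (ler_wpM2r (normr_ge0 _) (alpha_ge_inf k.+2)) _.
have := fb_step_ratio (x k) (alpha_gt0 k.+1) (alpha_gt0 k.+2).
rewrite -(run_step run) -(run_step run) => /le_trans; apply.
by rewrite ler_wpM2r// lerD2r alpha_bounded.
Qed.

Lemma gap_ge0 v k : S v -> 0 <= psi (x k) - psi v.
Proof.
move=> Sv; have := (stationary_argmin v).1 Sv (x k).
rewrite (objectiveE (iterate_dom k)) (objectiveE (stationary_dom Sv)) lee_fin.
by rewrite subr_ge0.
Qed.

Lemma steps_sq_bounded : exists B, forall n, \sum_(k < n) d k ^+ 2 <= B.
Proof.
have [v Sv] := S_neq0.
have c_gt0 : 0 < delta * alpha_inf by rewrite mulr_gt0.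
have C_ge1 : 1 <= (A + L) / alpha_inf.
  rewrite ler_pdivlMr// mul1r; apply: le_trans (alpha_ge_inf 1) _.
  by apply: le_trans (alpha_bounded 0) _; rewrite lerDl ltW.
apply: (@sum_sq_bounded _ (fun k => psi (x k) - psi v) d _ mmax c_gt0 _ _ _ C_ge1).
- by move=> k; exact: gap_ge0.
- move=> k b xb; rewrite lerBlDr addrAC.
  by apply: iterate_descent => j jM; rewrite -lerBlDr; exact: xb.
- by move=> k; exact: normr_ge0.
- exact: iterate_ratio.
Qed.

(** [fb_step_fejer] multiplied by [2 / alpha k.+1]; the bounds on the step
    parameters replace this factor by constants, which uses that the gap is
    nonnegative. *)
Lemma iterate_fejer v k : S v ->
  2 / A * (psi (x k.+1) - psi v) + `|x k.+1 - v| ^+ 2 <=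
    `|x k - v| ^+ 2 + 2 * L / alpha_inf * d k ^+ 2.
Proof.
move=> Sv; set a := alpha k.+1; have a0 : 0 < a := alpha_gt0 k.+1.
have q0 := gap_ge0 k.+1 Sv.
have := fb_step_fejer a0 (iterate_dom k) (stationary_dom Sv); rewrite -(run_step run) -/(x k.+1).
rewrite -(normrN (x k - x k.+1)) opprB -/(d k).
move: q0; set q := psi _ - _; set X := `|x k - v| ^+ 2; set Y := `|x k.+1 - v| ^+ 2.
have := exprn_ge0 2 (normr_ge0 (x k.+1 - x k)); rewrite -/(d k); set D := d k ^+ 2.
move=> D0 q0 le.
have ia0 : 0 < 2 / a by rewrite divr_gt0.
have le1 := ler_wpM2l (ltW ia0) le.
have E : 2 / a * (a / 2 * (X - Y) + (L - a / 2) * D) =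
    X - Y + 2 / a * L * D - D by field; lra.
have le2 : 2 / A * q <= 2 / a * q.
  by rewrite ler_wpM2r// ler_wpM2l// lef_pV2 ?posrE// alpha_bounded.
have le3 : 2 / a * L * D <= 2 * L / alpha_inf * D.
  rewrite ler_wpM2r// [X in X <= _]mulrAC ler_wpM2l ?mulr_ge0// ?(ltW L_gt0)//.
  by rewrite lef_pV2 ?posrE// alpha_ge_inf.
by move: le1; rewrite E; lra.
Qed.

Lemma objective_gap_sum_bounded v : S v ->
  exists B, forall n, \sum_(k < n) (psi (x k) - psi v) <= B.
Proof.
move=> Sv; have [B dB] := steps_sq_bounded.
pose c := 2 * L / alpha_inf.
have c0 : 0 <= c by rewrite divr_ge0 ?mulr_ge0// ltW.
have partial n : \sum_(k < n) (2 / A * (psi (x k.+1) - psi v)) + `|x n - v| ^+ 2 <=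
    `|x 0%N - v| ^+ 2 + c * \sum_(k < n) d k ^+ 2.
  elim: n => [|n IH]; first by rewrite !big_ord0 mulr0 add0r addr0.
  rewrite !big_ord_recr /= mulrDr.
  have := iterate_fejer n Sv; rewrite -/c; lra.
have shifted n : \sum_(k < n) (psi (x k.+1) - psi v) <= A / 2 * (`|x 0%N - v| ^+ 2 + c * B).
  have := partial n; rewrite -mulr_sumr.
  have := ler_wpM2l c0 (dB n); have := exprn_ge0 2 (normr_ge0 (x n - v)).
  set s := \sum_(k < n) (_ - _) => le1 le2 le3.
  have -> : s = A / 2 * (2 / A * s) by field; rewrite gt_eqF.
  by rewrite ler_wpM2l ?divr_ge0 ?(ltW A_gt0)//; lra.
exists (psi (x 0%N) - psi v + A / 2 * (`|x 0%N - v| ^+ 2 + c * B)) => n.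
apply: (@le_trans _ _ (\sum_(k < n.+1) (psi (x k) - psi v))).
  by rewrite big_ord_recr /= lerDl gap_ge0.
by rewrite big_ord_recl /= lerD2l; exact: shifted.
Qed.

Lemma objective_gap_rate v : S v ->
  exists2 K, 0 <= K & forall n, n%:R * (psi (x n) - psi v) <= K.
Proof.
move=> Sv; have [B gapB] := objective_gap_sum_bounded Sv.
exists (mmax.+1%:R * B).
  by rewrite mulr_ge0//; have := gapB 0%N; rewrite big_ord0.
have c_gt0 : 0 < delta * alpha_inf by rewrite mulr_gt0.
apply: (@nonmonotone_rate _ _ d _ _ c_gt0) => // [k|k b xb].
  exact: gap_ge0.
rewrite lerBlDr addrAC.
by apply: iterate_descent => j jM; rewrite -lerBlDr; exact: xb.
Qed.

Lemma sublevel_stationary v : S v -> S = [set y | (Psi y <= (psi v)%:E)%E].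
Proof.
move=> Sv; have vmin := (stationary_argmin v).1 Sv.
apply/seteqP; split=> y; rewrite -(objectiveE (stationary_dom Sv)) /=.
  by move=> Sy; apply: ((stationary_argmin y).1 Sy).
move=> yv; apply/stationary_argmin => z; exact: le_trans yv (vmin z).
Qed.

(** Since the gaps tend to 0, each sublevel set above the minimum contains a tail
    of the sequence, and the solution set is the intersection of these closed
    convex sets. *)
Lemma iterate_cluster l :
  (forall C, closed C -> convex_subset C -> (\forall k \near \oo, C (x k)) -> C l) ->
  S l.
Proof.
move=> lC; have [v Sv] := S_neq0; have [K K0 rate] := objective_gap_rate Sv.
have le_eps e : 0 < e -> (Psi l <= (psi v + e)%:E)%E.
  move=> e0; apply: (lC [set y | (Psi y <= (psi v + e)%:E)%E]).
  - exact: closed_sublevel.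
  - exact: convex_sublevel.
  near=> k; rewrite /= (objectiveE (iterate_dom k)) lee_fin -lerBlDl.
  have k0 : 0 < (k%:R : R) by near: k; exact: nbhs_infty_gtr.
  have kK : K / e < k%:R by near: k; exact: nbhs_infty_gtr.
  rewrite -(ler_pM2l k0); apply: le_trans (rate k) _.
  by rewrite -ler_pdivrMr// ltW.
rewrite (sublevel_stationary Sv) /=; apply/lee_addgt0Pr => e e0.
by rewrite -EFinD le_eps.
Unshelve. all: by end_near.
Qed.

Lemma iterate_weak_cvg : exists z, [/\ S z, weak_cvg dot x z &
  orth_proj S (x k) @[k --> \oo] --> z].
Proof.
have [v Sv] := S_neq0; have [B dB] := steps_sq_bounded.
pose c := 2 * L / alpha_inf; pose E n := c * \sum_(k < n) d k ^+ 2.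
have c0 : 0 <= c by rewrite divr_ge0 ?mulr_ge0// ltW.
have clS : closed S by rewrite (sublevel_stationary Sv); exact: closed_sublevel.
have cvS : convex_subset S by rewrite (sublevel_stationary Sv); exact: convex_sublevel.
have E_ge0 n : 0 <= E n by rewrite mulr_ge0// sumr_ge0// => k _; exact: sqr_ge0.
have E_le n : E n <= c * B by rewrite ler_wpM2l.
have fejer w m n : S w -> (n <= m)%N ->
    `|x m - w| ^+ 2 - E m <= `|x n - w| ^+ 2 - E n.
  move=> Sw nm; rewrite -(subnKC nm); elim: (m - n)%N => [|p IH]; first by rewrite addn0.
  apply: le_trans IH; rewrite addnS /E big_ord_recr /= mulrDr.
  have := iterate_fejer (n + p) Sw; rewrite -/c.
  have : 0 <= 2 / A * (psi (x (n + p).+1) - psi w).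
    by rewrite mulr_ge0 ?divr_ge0 ?(ltW A_gt0)// gap_ge0.
  by lra.
exists (limn (fun k => orth_proj S (x k))); split.
- exact: (quasi_fejer_lim_mem hdot clS cvS S_neq0 E_le fejer).
- exact: (quasi_fejer_weak_cvg hdot clS cvS S_neq0 E_ge0 E_le fejer iterate_cluster).
- exact: (quasi_fejer_proj_cvg hdot clS cvS S_neq0 E_le fejer).
Qed.

Lemma weak_accumulation_stationary l : weak_accumulation dot u l -> S l.
Proof.
move=> [phi [phi_incr ul]]; apply: iterate_cluster => C clC cvC [N _ NC].
apply: (closed_convex_weak_limit hdot clC cvC ul).
have phi_ge k : (k <= phi k)%N.
  by elim: k => // k IH; apply: leq_ltn_trans IH _; exact: phi_incr.
exists N.+1 => // k Nk /=; have := leq_trans Nk (phi_ge k).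
by case: (phi k) => // m; rewrite ltnS => /NC.
Qed.

Lemma min_valueE v : S v -> min_value Psi = (psi v)%:E.
Proof.
move=> Sv; have vmin := (stationary_argmin v).1 Sv.
rewrite -(objectiveE (stationary_dom Sv)); apply/eqP; rewrite eq_le; apply/andP; split.
  by apply: ereal_inf_lbound; exists v => //.
by apply: le_ereal_inf_tmp => _ [y _ <-]; exact: vmin.
Qed.

Lemma objective_cvg : Psi (u k) @[k --> \oo] --> min_value Psi.
Proof.
have [v Sv] := S_neq0; have [K K0 rate] := objective_gap_rate Sv.
rewrite (min_valueE Sv) -(cvg_shiftS (fun k => Psi (u k))).
rewrite (_ : [sequence _]_n = (fun n => (psi (x n))%:E)); last first.
  by apply/funext => n; rewrite -(objectiveE (iterate_dom n)).
apply: cvg_EFin; first by near=> k.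
apply/cvgrPdist_le => e e0; near=> k.
rewrite /= distrC ger0_norm ?gap_ge0//.
have k0 : 0 < (k%:R : R) by near: k; exact: nbhs_infty_gtr.
have kK : K / e < k%:R by near: k; exact: nbhs_infty_gtr.
rewrite -(ler_pM2l k0); apply: le_trans (rate k) _.
by rewrite -ler_pdivrMr// ltW.
Unshelve. all: by end_near.
Qed.

Lemma objective_rate : exists rho1 rho2 : R,
  [/\ 0 < rho1, 0 < rho2 &
    \forall k \near \oo, (Psi (u k) - min_value Psi <= (rho1 / (rho2 + k%:R))%:E)%E].
Proof.
have [v Sv] := S_neq0; have [K K0 rate] := objective_gap_rate Sv.
(* With [k = n.+2], the bound [K / n.+1] on the gap of [x n.+1 = u k] is to be
   compared with [1 / (1 + k)], and [1 + k = n + 3 <= 3 * n.+1]. *)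
exists (3 * K + 1), 1; split; [lra | exact: ltr01 |].
exists 2%N => // -[|[|n]] //= _; have := rate n.+1.
rewrite (min_valueE Sv) (objectiveE (iterate_dom n.+1)) -EFinB lee_fin.
rewrite ler_pdivlMr ?ltr_pwDl// -[n.+2]addn1 -[n.+1]addn1 !natrD.
have : 0 <= (n%:R : R) by exact: ler0n.
move: (n%:R : R) (psi _ - psi v) => N q N0 Nq; nra.
Qed.

End Run.

End CompositeProblem.

Theorem theorem3 (R : realType) (H : completeNormedModType R)
  (dot : {dot H for idfun}) (hdot : induces_norm dot)
  (F Reg : H -> \bar R) (gradF : H -> H) (L : R)
  (Reg_proper : proper_fun Reg)
  (Reg_convex : econvex Reg)
  (Reg_lsc : lower_semicontinuous Reg)
  (F_gtNy : forall u, (-oo < F u)%E)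
  (F_convex : econvex F)
  (F_C1 : C1_on_interior F)
  (F_dom : edom Reg `<=` (edom F)°)
  (F_grad : is_gradient dot F gradF)
  (L_gt0 : 0 < L)
  (gradF_lip : L.-lipschitz gradF)
  (S_neq0 : stationary dot gradF Reg !=set0)
  (delta : R) (delta_gt0 : 0 < delta) (delta_lt1 : delta < 1)
  (mmax : nat)
  (eta : R) (eta_gt1 : 1 < eta)
  (alpha_inf alpha_sup : R)
  (alpha_inf_gt0 : 0 < alpha_inf) (alpha_inf_sup : alpha_inf < alpha_sup)
  (alpha_init : R) (alpha_init_gt0 : 0 < alpha_init)
  (u : nat -> H) (alpha alphaBB : nat -> R) (i : nat -> nat)
  (run : splitting_run dot F gradF Reg delta mmax eta alpha_inf alpha_sup
           alpha_init u alpha alphaBB i) :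
  let Psi := objective F Reg in
  let Psi_star := min_value Psi in
  let S := stationary dot gradF Reg in
  [/\ forall l : H, weak_accumulation dot u l -> S l,
      exists ustar : H,
        [/\ S ustar, argmin Psi ustar, weak_cvg dot u ustar
          & orth_proj S (u k) @[k --> \oo] --> ustar]
    & Psi (u k) @[k --> \oo] --> Psi_star /\
      exists rho1 rho2 : R,
        [/\ 0 < rho1, 0 < rho2
          & \forall k \near \oo,
              (Psi (u k) - Psi_star <= (rho1 / (rho2 + k%:R))%:E)%E]].
Proof.
split.
- move=> l; exact: (weak_accumulation_stationary hdot Reg_proper Reg_convex Reg_lsc
    F_gtNy F_convex F_C1 F_dom F_grad L_gt0 gradF_lip S_neq0 delta_gt0 delta_lt1
    eta_gt1 alpha_inf_gt0 alpha_inf_sup run).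
- have [z [Sz uz Pz]] := iterate_weak_cvg hdot Reg_proper Reg_convex Reg_lsc
    F_gtNy F_convex F_C1 F_dom F_grad L_gt0 gradF_lip S_neq0 delta_gt0 delta_lt1
    eta_gt1 alpha_inf_gt0 alpha_inf_sup run.
  exists z; split => //.
  + exact: (stationary_argmin hdot Reg_proper Reg_convex F_gtNy F_convex F_C1 F_dom
      F_grad gradF_lip z).1 Sz.
  + by move=> h; rewrite -(cvg_shiftS (fun k => dot (u k) h)); exact: uz.
  + by rewrite -(cvg_shiftS (fun k => orth_proj _ (u k))); exact: Pz.
- split; first exact: (objective_cvg hdot Reg_proper Reg_convex Reg_lsc
    F_gtNy F_convex F_C1 F_dom F_grad L_gt0 gradF_lip S_neq0 delta_gt0 delta_lt1
    eta_gt1 alpha_inf_gt0 alpha_inf_sup run).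
  exact: (objective_rate hdot Reg_proper Reg_convex Reg_lsc
    F_gtNy F_convex F_C1 F_dom F_grad L_gt0 gradF_lip S_neq0 delta_gt0 delta_lt1
    eta_gt1 alpha_inf_gt0 alpha_inf_sup run).
Qed.
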